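(* Let $\mathfrak V$ be a locally finite variety of algebras over a field $\mathbf F$. Then every subalgebra $B$ of every finite algebra $A\in\mathfrak V$ is a subideal of $A$ if and only if $\mathfrak V$ is locally nilpotent.
   Context: An algebra over a field $\mathbf F$ is a vector space over $\mathbf F$ with a bilinear multiplication (not assumed associative, commutative or unital). A variety of $\mathbf F$-algebras is the class of all $\mathbf F$-algebras satisfying a given set of polynomial identities $v(x_1,\dots,x_n)=0$, where each $v$ is a nonassociative polynomial over $\mathbf F$ without constant term. A variety is locally finite if every finitely generated algebra in it is finite. For an algebra $A$, put $A^1=A$ and $A^k=\sum_{s+t=k}A^sA^t$, where $LM$ denotes the linear span of all products $lm$, $l\in L$, $m\in M$. $A$ is nilpotent if $A^{c+1}=\{0\}$ for some $c\ge 1$. A variety is locally nilpotent if every finitely generated algebra in it is nilpotent. An ideal means a two-sided ideal. A subalgebra $B$ of $A$ is a subideal of $A$ if there is a finite series of subalgebras $B=B_0\subset B_1\subset\dots\subset B_s=A$ such that $B_{i-1}$ is an ideal of $B_i$ for all $i=1,\dots,s$. *)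

(* Defs.v *)
From HB Require Import structures.
From mathcomp Require Import all_boot all_order all_algebra.
From mathcomp Require Import sesquilinear.
From mathcomp Require Import finmap.
From mathcomp Require Import monalg.
From mathcomp Require Import boolp classical_sets.

Set Implicit Arguments.
Unset Strict Implicit.
Unset Printing Implicit Defensive.

Import GRing.Theory.
Local Open Scope ring_scope.
Local Open Scope classical_set_scope.

HB.mixin Record Lmodule_hasBilinearMul (F : fieldType) A
    of GRing.Lmodule F A := {
  amul : A -> A -> A;
  amul_bilinear_subproof : bilinear_for *:%R *:%R amul
}.

(* Only bilinearity is required of the multiplication; the structures algType
   and lalgType of MathComp are unital and associative. *)
#[short(type="naAlgType")]
HB.structure Definition NonassocAlgebra (F : fieldType) :=
  {A of GRing.Lmodule F A & Lmodule_hasBilinearMul F A}.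

HB.instance Definition _ (F : fieldType) (A : naAlgType F) :=
  bilinear_isBilinear.Build F A A A *:%R *:%R (@amul F A)
    (@amul_bilinear_subproof F A).

Declare Scope naalg_scope.
Delimit Scope naalg_scope with NA.
Local Open Scope naalg_scope.
Notation "x ** y" := (amul x y) (at level 40, left associativity) : naalg_scope.

(* The free magma on the variables x_0, x_1, ...: there is no empty monomial,
   so that the polynomials below have no constant term. *)
Inductive namonom : Type :=
| NAVar of nat
| NAMul of namonom & namonom.

Fixpoint namonom_to_tree (m : namonom) : GenTree.tree nat :=
  match m with
  | NAVar i => GenTree.Leaf i
  | NAMul m1 m2 => GenTree.Node 0%N [:: namonom_to_tree m1; namonom_to_tree m2]
  end.

Fixpoint tree_to_namonom (t : GenTree.tree nat) : option namonom :=
  match t with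
  | GenTree.Leaf i => Some (NAVar i)
  | GenTree.Node _ [:: t1; t2] =>
      match tree_to_namonom t1, tree_to_namonom t2 with
      | Some m1, Some m2 => Some (NAMul m1 m2)
      | _, _ => None
      end
  | _ => None
  end.

Lemma namonom_to_treeK : pcancel namonom_to_tree tree_to_namonom.
Proof. by elim=> [i|m1 IH1 m2 IH2] //=; rewrite IH1 IH2. Qed.

HB.instance Definition _ := Countable.copy namonom (pcan_type namonom_to_treeK).

Notation "{ 'napoly' F }" := {malg F[namonom]}
  (at level 0, F at level 2, format "{ 'napoly'  F }") : type_scope.

Section Evaluation.
Variables (F : fieldType) (A : naAlgType F).

Fixpoint namonom_eval (a : nat -> A) (m : namonom) : A :=
  match m with
  | NAVar i => a i
  | NAMul m1 m2 => namonom_eval a m1 ** namonom_eval a m2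
  end.

Definition napoly_eval (a : nat -> A) (v : {napoly F}) : A :=
  \sum_(m <- msupp v) v@_m *: namonom_eval a m.

Definition in_variety (V : set {napoly F}) : Prop :=
  forall v, V v -> forall a : nat -> A, napoly_eval a v = 0.

End Evaluation.

Section Subsets.
Variables (F : fieldType) (A : naAlgType F).
Implicit Types (B C I L M X : set A).

Definition subspace L : Prop :=
  [/\ L 0, forall x y, L x -> L y -> L (x + y)
         & forall (c : F) x, L x -> L (c *: x)].

Definition lspan X : set A := smallest subspace X.

Definition subalgebra B : Prop :=
  subspace B /\ forall x y, B x -> B y -> B (x ** y).

Definition generated_subalgebra X : set A := smallest subalgebra X.

Definition ideal_of I C : Prop :=
  [/\ I `<=` C, subspace I
    & forall x c, I x -> C c -> I (x ** c) /\ I (c ** x)].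

Definition subideal B : Prop :=
  exists (s : nat) (B_ : nat -> set A),
    [/\ B_ 0%N = B, B_ s = setT,
        forall i, (i <= s)%N -> subalgebra (B_ i)
      & forall i, (0 < i <= s)%N -> ideal_of (B_ i.-1) (B_ i)].

Definition prod_space L M : set A :=
  lspan [set z | exists l m, [/\ L l, M m & z = l ** m]].

(* The sum of the subspaces P s P t with s + t = k and s, t >= 1. *)
Definition sum_prod (P : nat -> set A) (k : nat) : set A :=
  lspan [set z | exists s t, [/\ (0 < s)%N, (0 < t)%N, (s + t)%N = k
                                & prod_space (P s) (P t) z]].

(* Course-of-values recursion: apow_upto n k is the k-th power as soon as
   k <= n.+1, and the recursive calls in sum_prod only use indices below k. *)
Fixpoint apow_upto (n : nat) : nat -> set A :=
  if n isn't n'.+1 then fun=> setT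
  else fun k => if (k <= 1)%N then setT else sum_prod (apow_upto n') k.

(* Powers are meant for k >= 1; the value setT at k = 0 is never used. *)
Definition apow (k : nat) : set A := apow_upto k k.

Lemma apow1 : apow 1%N = setT. Proof. by []. Qed.

Lemma eq_sum_prod (P Q : nat -> set A) k :
  (forall i, (0 < i < k)%N -> P i = Q i) -> sum_prod P k = sum_prod Q k.
Proof.
move=> PQ; congr (lspan _); apply/seteqP; split=> z [s [t [s0 t0 stk zst]]];
  exists s, t; split=> //.
all: have sk : (0 < s < k)%N by rewrite s0 -stk -addn1 leq_add2l.
all: have tk : (0 < t < k)%N by rewrite t0 -stk -add1n leq_add2r.
all: by move: zst; rewrite (PQ s sk) (PQ t tk).
Qed.

Lemma apow_uptoE n m k : (0 < k)%N -> (k <= n.+1)%N -> (k <= m.+1)%N ->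
  apow_upto n k = apow_upto m k.
Proof.
have upto1 p : apow_upto p 1%N = setT by case: p.
elim: n m k => [|n IHn] [|m] [|[|k]] // _ kn km; rewrite ?upto1 //=.
apply: eq_sum_prod => i /andP[i0 ik].
by apply: IHn => //; rewrite -ltnS; apply: leq_trans ik _.
Qed.

Lemma apowE k : (1 < k)%N -> apow k = sum_prod apow k.
Proof.
case: k => [|[|k]] // _.
have -> : apow k.+2 = sum_prod (apow_upto k.+1) k.+2 by [].
apply: eq_sum_prod => i /andP[i0 ik].
by apply: (@apow_uptoE k.+1 i i) => //; apply: ltnW.
Qed.

End Subsets.

Section Finiteness.
Variables (F : fieldType) (A : naAlgType F).

Definition finite_algebra : Prop := exists s : seq A, forall x : A, x \in s.

Definition finitely_generated : Prop :=
  exists s : seq A, generated_subalgebra [set x | x \in s] = setT.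

Definition nilpotent_algebra : Prop :=
  exists2 c : nat, (1 <= c)%N & @apow F A c.+1 = [set 0].

End Finiteness.

Arguments finite_algebra {F} A.
Arguments finitely_generated {F} A.
Arguments nilpotent_algebra {F} A.
Arguments in_variety {F} A V.

(* A variety is presented by a set V of polynomials; its members are the
   algebras A with in_variety A V. *)
Definition locally_finite (F : fieldType) (V : set {napoly F}) : Prop :=
  forall A : naAlgType F,
    in_variety A V -> finitely_generated A -> finite_algebra A.

Definition locally_nilpotent (F : fieldType) (V : set {napoly F}) : Prop :=
  forall A : naAlgType F,
    in_variety A V -> finitely_generated A -> nilpotent_algebra A.

(* Main.v *)
(** If the diagonal D of A x A is a subideal, through a series
    D = C_0, ..., C_s = A x A, put I_i = {x | (x, 0) \in C_i}.  As each C_i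
    contains D, multiplying (x, 0) \in C_i by (a, a) gives an element of
    C_(i-1), so that A I_i + I_i A is contained in I_(i-1), with I_s = A and
    I_0 = 0.  A product of at least 2^d factors involves d nested
    multiplications, so A^k lies in I_(s-d) for k >= 2^d, and A^(2^s) = 0.
    Conversely, if A^(c+1) = 0 then the subalgebras B + A^(c+1-i) form a series
    from B to A. *)
Require Import Defs.
From HB Require Import structures.
From mathcomp Require Import all_boot all_order all_algebra.
From mathcomp Require Import sesquilinear.
From mathcomp Require Import finmap.
From mathcomp Require Import monalg.
From mathcomp Require Import zify.
From mathcomp Require Import boolp classical_sets.

Set Implicit Arguments.
Unset Strict Implicit.
Unset Printing Implicit Defensive.

Import GRing.Theory.
Local Open Scope ring_scope.
Local Open Scope classical_set_scope.
Local Open Scope naalg_scope.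

Section ProductAlgebra.
Variables (F : fieldType) (A B : naAlgType F).

Definition prod_amul (x y : A * B) : A * B := (x.1 ** y.1, x.2 ** y.2).

Lemma prod_amul_bilinear : bilinear_for *:%R *:%R prod_amul.
Proof.
by split=> u a x y; rewrite /prod_amul /= ?linearPl ?linearPr.
Qed.

HB.instance Definition _ :=
  Lmodule_hasBilinearMul.Build F (A * B)%type prod_amul_bilinear.

Lemma namonom_eval_prod (a : nat -> A * B) m :
  namonom_eval a m = (namonom_eval (fst \o a) m, namonom_eval (snd \o a) m).
Proof. by elim: m => [i|m1 IH1 m2 IH2] /=; [case: (a i) | rewrite IH1 IH2]. Qed.

Lemma napoly_eval_prod (a : nat -> A * B) v :
  napoly_eval a v = (napoly_eval (fst \o a) v, napoly_eval (snd \o a) v).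
Proof.
rewrite /napoly_eval; under eq_bigr do rewrite namonom_eval_prod.
by elim/big_rec3: _ => // m x y z _ ->.
Qed.

(** The projections commute with evaluation of polynomials. This places A x A in the variety, so
    that the subideal hypothesis can be applied to its diagonal. *)
Lemma in_variety_prod V :
  in_variety A V -> in_variety B V -> in_variety (A * B)%type V.
Proof. by move=> AV BV v Vv a; rewrite napoly_eval_prod AV ?BV. Qed.

Lemma finite_algebra_prod :
  finite_algebra A -> finite_algebra B -> finite_algebra (A * B)%type.
Proof.
move=> [s sP] [t tP]; exists [seq (x, y) | x <- s, y <- t] => -[x y].
exact: allpairs_f.
Qed.

End ProductAlgebra.

Section Powers.
Variables (F : fieldType) (A : naAlgType F).
Implicit Types (X L : set A).

Lemma lspan_sub X L : subspace L -> X `<=` L -> lspan X `<=` L.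
Proof. exact: smallest_sub. Qed.

Lemma sub_lspan X : X `<=` lspan X.
Proof. exact: sub_gen_smallest. Qed.

Lemma lspan_subspace X : subspace (lspan X).
Proof.
split=> [L [[L0 _ _] _]//|x y lx ly L LX|c x lx L LX].
  by case: (LX) => -[_ LD _] _; apply: LD; [apply: lx | apply: ly].
by case: (LX) => -[_ _ LZ] _; apply: LZ; apply: lx.
Qed.

(** A subspace absorbs both nested spans, the outer one and that inside each [prod_space], so only
    single products need testing. *)
Lemma sum_prod_sub (P : nat -> set A) k L : subspace L ->
    (forall s t x y, (0 < s)%N -> (0 < t)%N -> (s + t)%N = k ->
       P s x -> P t y -> L (x ** y)) ->
  sum_prod P k `<=` L.
Proof.
move=> sL PL; apply: lspan_sub => // z [s [t [s0 t0 st]]].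
apply: lspan_sub => //.
by move=> _ [x [y [Px Py ->]]]; apply: (PL s t).
Qed.

Lemma apow_subspace k : subspace (@apow F A k).
Proof.
by case: k => [|[|k]] //; rewrite apowE//; apply: lspan_subspace.
Qed.

Lemma apow_mul s t x y : (0 < s)%N -> (0 < t)%N ->
  apow s x -> apow t y -> @apow F A (s + t) (x ** y).
Proof.
move=> s0 t0 sx ty; rewrite apowE; last by rewrite -(addn1 1) leq_add.
apply: sub_lspan; exists s, t; split=> //.
by apply: sub_lspan; exists x, y.
Qed.

Lemma apowS_sub k : (0 < k)%N -> @apow F A k.+1 `<=` apow k.
Proof.
elim/ltn_ind: k => -[//|[//|k]] IHk _; rewrite apowE//.
apply: sum_prod_sub; first exact: apow_subspace.
(* The exponent of one factor is lowered by induction: the left one if it is at least 2, otherwise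
   the right one, which is then [k.+2]. *)
move=> [//|[|s]] t x y _ t0 st sx ty; last first.
  have -> : k.+2 = (s.+1 + t)%N by lia.
  by apply: apow_mul => //; apply: IHk sx => //; lia.
have -> : k.+2 = (1 + k.+1)%N by [].
apply: apow_mul => //; apply: IHk => //.
by have -> : k.+2 = t by lia.
Qed.

Lemma finite_algebra_fg : finite_algebra A -> finitely_generated A.
Proof.
move=> [s sP]; exists s; apply/seteqP; split=> // x _.
by apply: sub_gen_smallest; apply: sP.
Qed.

Lemma nilpotent_subideal (B : set A) :
  nilpotent_algebra A -> subalgebra B -> subideal B.
Proof.
move=> [c _ Ac0] [[B0 BD BZ] BM].
pose C k : set A := [set z | exists x y, [/\ B x, apow k y & z = x + y]].
have sC k : subspace (C k).
  have [P0 PD PZ] := apow_subspace k; split.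
  - by exists 0, 0; rewrite addr0.
  - move=> _ _ [x [y [Bx Py ->]]] [x' [y' [Bx' Py' ->]]].
    by exists (x + x'), (y + y'); rewrite addrACA; split=> //; auto.
  - move=> a _ [x [y [Bx Py ->]]].
    by exists (a *: x), (a *: y); rewrite scalerDr; split=> //; auto.
have CS k : (0 < k)%N -> C k.+1 `<=` C k.
  by move=> k0 _ [x [y [Bx Py ->]]]; exists x, y; split=> //; apply: apowS_sub.
have iC k : (0 < k)%N -> ideal_of (C k.+1) (C k).
  move=> k0; have [_ PD _] := apow_subspace k.+1.
  split=> //; first exact: CS.
  move=> _ _ [x [y [Bx Py ->]]] [x' [y' [Bx' Py' ->]]].
  have Pl u v : apow k v -> @apow F A k.+1 (u ** v).
    by move=> Pv; rewrite -add1n; apply: apow_mul.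
  have Pr u v : apow k u -> @apow F A k.+1 (u ** v).
    by move=> Pu; rewrite -addn1; apply: apow_mul.
  have Py'' := apowS_sub k0 Py.
  (* Once the product of the two B-parts is split off, every remaining term has a factor in A^k,
     hence lies in A^(k+1). *)
  split; [exists (x ** x'), (x ** y' + y ** (x' + y'))
         | exists (x' ** x), (x' ** y + y' ** (x + y))];
    by split; auto; rewrite linearDl addrA; congr (_ + _); rewrite linearDr.
(* [C 1] is all of A; each later [C k] is an ideal of its predecessor, hence closed under
   products. *)
have aC k : (0 < k)%N -> subalgebra (C k).
  case: k => [//|[|k]] _.
    by split=> // x y _ _; exists 0, (x ** y); rewrite add0r.
  split=> // x y Cx Cy; have [_ _ Ci] := iC k.+1 isT.
  by have [] := Ci x y Cx (CS k.+1 isT _ Cy).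
(* The index is reversed so that the series increases; it runs from c+1 down to 1 and never reaches
   the junk power 0. *)
exists c, (fun i => C (c.+1 - i)%N); split.
- rewrite subn0; apply/seteqP; split=> [z [x [y [Bx]]]|x Bx].
    by rewrite Ac0 => /= -> ->; rewrite addr0.
  by exists x, 0; rewrite Ac0 addr0.
- rewrite subSnn; apply/seteqP; split=> // x _.
  by exists 0, x; rewrite add0r.
- by move=> i ic; apply: aC; rewrite subn_gt0 ltnS.
- move=> [//|i] /= ic; rewrite subSS subSn ?(ltnW ic)//.
  by apply: iC; rewrite subn_gt0.
Qed.

Lemma central_series_nilpotent (s : nat) (I : nat -> set A) :
    (forall i, (i <= s)%N -> subspace (I i)) ->
    I 0%N `<=` [set 0] -> I s = setT ->
    (forall i x a, (i < s)%N -> I i.+1 x -> I i (x ** a) /\ I i (a ** x)) ->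
  nilpotent_algebra A.
Proof.
move=> sI I0 Is IM.
have apowI d k : (d <= s)%N -> (2 ^ d <= k)%N -> @apow F A k `<=` I (s - d)%N.
  elim: d k => [|d IHd] k ds dk; first by rewrite subn0 Is.
  have k1 : (1 < k)%N.
    by apply: leq_trans dk; rewrite expnS -[leqLHS]muln1 leq_mul ?expn_gt0.
  rewrite apowE//; apply: sum_prod_sub; first by apply: sI; apply: leq_subr.
  move=> t u x y _ _ tuk tx uy.
  have Isub : (s - d = (s - d.+1).+1)%N by rewrite -subSn// subSS.
  have lts : (s - d.+1 < s)%N by rewrite -Isub leq_subr.
  (* As t + u is at least 2^(d+1), one factor has exponent at least 2^d. Only that factor is
     tracked; the other counts as an arbitrary element of A. *)
  have [dt|td] := leqP (2 ^ d) t.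
    have := IHd t (ltnW ds) dt x tx.
    by rewrite Isub => /IM-/(_ y lts)[].
  have du : (2 ^ d <= u)%N by move: dk; rewrite expnS; lia.
  have := IHd u (ltnW ds) du y uy.
  by rewrite Isub => /IM-/(_ x lts)[].
(* Taking 2^s instead of 2^s - 1 keeps the class positive when s = 0. *)
exists (2 ^ s)%N; first by rewrite expn_gt0.
apply/seteqP; split=> [x /(apowI s _ (leqnn s) (leqnSn _))|_ ->].
  by rewrite subnn => /I0.
by have [] := apow_subspace (2 ^ s).+1.
Qed.

Definition diagonal : set (A * A) := [set z | z.1 = z.2].

Lemma diagonal_subalgebra : subalgebra diagonal.
Proof.
split; first split=> //.
- by move=> [x x'] [y y']; rewrite /diagonal /= => -> ->.
- by move=> c [x x']; rewrite /diagonal /= => ->.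
- by move=> [x x'] [y y']; rewrite /diagonal /= => -> ->.
Qed.

Lemma diagonal_subideal_nilpotent : subideal diagonal -> nilpotent_algebra A.
Proof.
move=> [s [C [C0 Cs aC iC]]].
have diagC i : (i <= s)%N -> diagonal `<=` C i.
  elim: i => [_|i IHi ilts]; first by rewrite C0.
  have [sub _ _] := iC i.+1 ilts.
  exact: subset_trans (IHi (ltnW ilts)) sub.
apply: (@central_series_nilpotent s (fun i => [set x | C i (x, 0)])).
- move=> i /aC[[C0i CD CZ] _]; split=> //= [x y Cx Cy|c x Cx].
    by have := CD _ _ Cx Cy; rewrite /= -[(x, 0) + _]/(_, _) addr0.
  by have := CZ c _ Cx; rewrite -[c *: _]/(_, _) scaler0.
- by rewrite C0.
- by rewrite Cs; apply/seteqP.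
- move=> i x a ilts Cx; have [_ _ CM] := iC i.+1 ilts.
  (* Here (a, a) is the member of the ideal [C i] and (x, 0) the element of the larger [C i.+1]. *)
  have [] := CM (a, a) (x, 0) (diagC i (ltnW ilts) (a, a) erefl) Cx.
  rewrite /= -[(a, a) ** _]/(_, _) -[_ ** (a, a)]/(_, _) /=.
  by rewrite linear0l linear0r.
Qed.

End Powers.

Theorem theorem2 (F : fieldType) (V : set {napoly F}) :
  locally_finite V ->
  (forall A : naAlgType F, in_variety A V -> finite_algebra A ->
     forall B : set A, subalgebra B -> subideal B) <->
  locally_nilpotent V.
Proof.
move=> lfV; split=> [subV A AV fgA | lnV A AV finA B sB].
  (* Local finiteness makes A, and so A x A, finite, as the subideal hypothesis requires. *)
  have finA := lfV A AV fgA.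
  apply: diagonal_subideal_nilpotent; apply: subV (diagonal_subalgebra A).
    exact: in_variety_prod.
  exact: finite_algebra_prod.
apply: nilpotent_subideal sB; apply: lnV => //.
exact: finite_algebra_fg.
Qed.
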